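(* Let $\sigma\ge 0$, let $f\colon\mathbb R\to\mathbb R$ be an $S^1$-almost periodic function and assume that there exists $\varsigma>0$ such that $f(t)-\sigma>\varsigma$ for a.e. $t\in\mathbb R$. Then for every $t\in\mathbb R$ the firing rate $\mathrm{Fr}(t)$ for the LIF model driven by $f$ exists, and moreover $\mathrm{Fr}(t)=\mathrm{Fr}(0)\in(0,+\infty)$ for $t\in\mathbb R$.
   Context: LIF model: for $\sigma\ge0$ and $f\in L^1_{\mathrm{loc}}(\mathbb R)$, the leaky integrate-and-fire (LIF) model driven by $f$ is $\dot x(t)=-\sigma x(t)+f(t)$ for a.e. $t\in\mathbb R$, with the resetting condition: $x(s)=1\Rightarrow\lim_{t\to s^+}x(t)=0$. Firing map: $\Phi(t)=\inf\{t_*>t : e^{\sigma t}\le\int_t^{t_*}(f(u)-\sigma)e^{\sigma u}\,du\}$; $\Phi(t)$ is well-defined (defined) if this set is non-empty. Firing rate at $t\in\mathbb R$: $\mathrm{Fr}(t)=\lim_{n\to\infty}\frac{n}{\Phi^n(t)}$ whenever this limit exists, where $\Phi^n$ is the $n$-th iterate of $\Phi$ (it is implicit that all iterates $\Phi^n(t)$ are well-defined). A set $A\subseteq\mathbb R$ is relatively dense if there is $l>0$ such that $A\cap(x,x+l)\neq\emptyset$ for every $x\in\mathbb R$. For $f\colon\mathbb R\to\mathbb R$ and $\tau\in\mathbb R$, $f^\tau(t)=f(t+\tau)$. $S^1$-almost periodic: $f\in L^1_{\mathrm{loc}}(\mathbb R)$ (functions identified a.e.) such that for every $\varepsilon>0$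 the set $\{\tau\in\mathbb R:\|f^\tau-f\|_{S^1_1}<\varepsilon\}$ is relatively dense, where $\|g\|_{S^1_1}=\sup_{t\in\mathbb R}\int_t^{t+1}|g(u)|\,du$. *)

(* Defs.v *)
From mathcomp Require Import all_boot all_order all_algebra.
From mathcomp Require Import all_classical all_reals all_analysis.
Set Implicit Arguments.
Unset Strict Implicit.
Unset Printing Implicit Defensive.
Import Order.TTheory GRing.Theory Num.Theory.
Import numFieldNormedType.Exports.

Local Open Scope classical_set_scope.
Local Open Scope ring_scope.

Definition relatively_dense (R : realType) (A : set R) : Prop :=
  exists2 l : R, 0 < l & forall x : R, A `&` `]x, x + l[ !=set0.

Definition S1_norm (R : realType) (g : R -> R) : \bar R :=
  ereal_sup
    (range (fun t : R =>
      (\int[lebesgue_measure]_(u in `[t, (t + 1)%R]) `|g u|%:E)%E)).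

(* [f \o shift tau] is the translate [fun t => f (t + tau)]. An element of
   L^1_loc is given by a Borel representative, as [locally_integrable] asks for
   measurability with respect to the Borel sets; everything below depends only
   on the a.e. class of [f]. *)
Definition S1_almost_periodic (R : realType) (f : R -> R) : Prop :=
  locally_integrable [set: R] f /\
  forall eps : R, 0 < eps ->
    relatively_dense
      [set tau : R | (S1_norm ((f \o shift tau) \- f)%R < eps%:E)%E].

Definition firing_times (R : realType) (sigma : R) (f : R -> R) (t : R) :
    set R :=
  [set s | t < s /\
    expR (sigma * t) <=
      \int[lebesgue_measure]_(u in `[t, s]) ((f u - sigma) * expR (sigma * u))].

Definition firing_defined (R : realType) (sigma : R) (f : R -> R) (t : R) :
    Prop :=
  firing_times sigma f t !=set0.

(* Meaningful only where [firing_defined] holds: [inf set0 = 0]. *)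
Definition firing_map (R : realType) (sigma : R) (f : R -> R) (t : R) : R :=
  inf (firing_times sigma f t).

(* The term with [iter n _ t = 0] is 0 by the convention on division by 0; when
   the iterates are defined they strictly increase, so at most one term is
   concerned and the limit is not affected. *)
Definition firing_quotient (R : realType) (sigma : R) (f : R -> R) (t : R) :
    R^nat :=
  fun n => n%:R / iter n (firing_map sigma f) t.

Definition firing_rate_exists (R : realType) (sigma : R) (f : R -> R) (t : R) :
    Prop :=
  (forall n, firing_defined sigma f (iter n (firing_map sigma f) t)) /\
  cvgn (firing_quotient sigma f t).

(* Meaningful only where [firing_rate_exists] holds. *)
Definition firing_rate (R : realType) (sigma : R) (f : R -> R) (t : R) : R :=
  limn (firing_quotient sigma f t).

(* Main.v *)
Require Import Defs.
From mathcomp Require Import all_boot all_order all_algebra.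
From mathcomp Require Import all_classical all_reals all_analysis.
From mathcomp Require Import measurable_realfun.
From mathcomp Require Import ring lra zify.
Set Implicit Arguments.
Unset Strict Implicit.
Unset Printing Implicit Defensive.
Import Order.TTheory GRing.Theory Num.Theory.
Import numFieldNormedType.Exports.

Local Open Scope classical_set_scope.
Local Open Scope ring_scope.

(** Let F be a primitive of u |-> (f u - sigma) * expR (sigma * u). The firing
    map Phi is characterised by F (Phi t) = F t + expR (sigma * t), and F grows
    at a rate bounded below. As sigma is nonnegative, Phi is increasing, and its
    gaps Phi t - t lie below a constant. Orbits of an increasing map interlace,
    hence any two of them have the same number of points in an interval up to
    one unit, and the rate of firing is the density of the points of a single
    orbit.

    To see that this density exists, let w k be the number of points of the
    orbit of t0 up to time t0 + k. The increment of w over a window of length L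
    depends on the position of the window in an almost periodic way, up to an
    error C that does not depend on L (lemma orbit_count_almost_periodic). This
    holds because orbits driven by f and by a translate f^tau close to f in
    S^1-norm stay interlaced as long as desired: the distance between two
    orbits, measured by F, never shrinks under Phi, so that an initial lead of
    one firing is lost only after the errors committed at each step, which are
    proportional to the S^1-distance, have added up to it (lemma
    orbit_comparison).

    It remains to extract a density from almost periodic windows (lemma
    almost_periodic_increments_almost_additive). The set of almost periods
    depends on L, and its gaps may be far longer than L, so tiling the line by
    windows that all look like a given one is impossible. Instead, M windows
    of length L started at consecutive integers are summed: the sum is L times
    the increment of w over length M, up to a term independent of M. Moving the
    whole family by one almost period changes the sum by at most C * M.
    Dividing by L, the increment of w over length M is independent of its
    starting point up to (C / L) * M plus a constant, and L is arbitrary. So w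
    is additive up to a sublinear error, which forces w n / n to converge.

    Finally, the numbers n and w k agree up to a constant at the n-th firing
    time, so n divided by this time has the same limit; the limit is positive
    because the gaps are bounded, and it does not depend on t because orbits
    interlace (lemma firing_system_rate). *)

(** * Sequences that are additive up to a sublinear error *)

(** The convergence of [v n / n] to [rho], in a form that survives bounded
    changes of [v] and reindexing without any division. *)
Definition sublinear_error (R : realType) (v : nat -> R) (rho : R) : Prop :=
  forall eps : R, 0 < eps ->
    exists K : R, forall n : nat, `|v n - rho * n%:R| <= eps * n%:R + K.

(** The error may grow with [n], but must be uniform in the starting point. *)
Definition almost_additive (R : realType) (v : nat -> R) : Prop :=
  forall eps : R, 0 < eps -> exists K : R, forall a n : nat,
    `|v (a + n)%N - v a - v n| <= eps * n%:R + K.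

Section almost_additive_sequences.
Variable R : realType.
Implicit Types (v : nat -> R) (eps K : R).

Lemma almost_additive_mul v eps K n :
  (forall a, `|v (a + n)%N - v a - v n| <= eps * n%:R + K) ->
  forall k, `|v (k.+1 * n)%N - k.+1%:R * v n| <= k%:R * (eps * n%:R + K).
Proof.
move=> vadd; elim=> [|k IHk]; first by rewrite mul1n mul1r subrr normr0 mul0r.
rewrite mulSnr.
have -> : v (k.+1 * n + n)%N - k.+2%:R * v n =
    (v (k.+1 * n + n)%N - v (k.+1 * n)%N - v n) +
    (v (k.+1 * n)%N - k.+1%:R * v n).
  by rewrite -[k.+2%:R]natr1; ring.
rewrite (le_trans (ler_normD _ _))// (le_trans (lerD (vadd _) IHk))//.
by rewrite -natr1; lra.
Qed.

(** Both ratios are compared with that of [v] at the product of the two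
    indices, which almost additivity relates to either of them. *)
Lemma almost_additive_ratio v eps K :
  (forall a n, `|v (a + n)%N - v a - v n| <= eps * n%:R + K) -> 0 <= eps ->
  0 <= K -> forall m n,
  `|v m.+1 / m.+1%:R - v n.+1 / n.+1%:R| <=
     2 * eps + K / m.+1%:R + K / n.+1%:R.
Proof.
move=> vadd eps0 K0 m n.
have A := almost_additive_mul (fun a => vadd a m.+1) n.
have B := almost_additive_mul (fun a => vadd a n.+1) m.
rewrite mulnC in A.
have m0 : 0 < m.+1%:R :> R by [].
have n0 : 0 < n.+1%:R :> R by [].
have -> : v m.+1 / m.+1%:R - v n.+1 / n.+1%:R =
    (n.+1%:R * v m.+1 - m.+1%:R * v n.+1) / (m.+1%:R * n.+1%:R).
  by field; rewrite !gt_eqF.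
rewrite normrM (ger0_norm (_ : 0 <= _^-1)); last first.
  by rewrite invr_ge0 mulr_ge0// ltW.
rewrite ler_pdivrMr ?mulr_gt0//.
have -> : (2 * eps + K / m.+1%:R + K / n.+1%:R) * (m.+1%:R * n.+1%:R) =
    n.+1%:R * (eps * m.+1%:R + K) + m.+1%:R * (eps * n.+1%:R + K).
  by field; rewrite !gt_eqF.
have -> : n.+1%:R * v m.+1 - m.+1%:R * v n.+1 =
  (v (m.+1 * n.+1)%N - m.+1%:R * v n.+1) -
  (v (m.+1 * n.+1)%N - n.+1%:R * v m.+1) by ring.
rewrite (le_trans (ler_normB _ _))// addrC lerD//.
  by apply: (le_trans A); rewrite ler_wpM2r// ?ler_nat// addr_ge0// mulr_ge0.
by apply: (le_trans B); rewrite ler_wpM2r// ?ler_nat// addr_ge0// mulr_ge0.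
Qed.

Lemma almost_additive_rate v :
  almost_additive v -> exists rho, sublinear_error v rho.
Proof.
move=> vadd.
have vaddK eps : 0 < eps -> exists2 K : R, 0 <= K & forall a n : nat,
    `|v (a + n)%N - v a - v n| <= eps * n%:R + K.
  move=> /vadd[K vK]; exists `|K| => // a n.
  by rewrite (le_trans (vK a n))// lerD2l ler_norm.
pose u n := v n.+1 / n.+1%:R.
have small (K e : R) : 0 < e -> exists N : nat, forall n, (N <= n)%N ->
    K / n.+1%:R <= e.
  move=> e0; exists (Num.truncn (K / e)) => n.
  by rewrite truncn_le_nat ltr_pdivrMr// ler_pdivrMr// mulrC => /ltW.
have cvgu : cvgn u.
  apply: cauchy_cvg; apply/cauchy_exP => e e0.
  have e8 : 0 < e / 8 by rewrite divr_gt0.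
  have [K K0 vK] := vaddK _ e8.
  have [N KN] := small K _ e8.
  exists (u N); exists N => // n /= Nn.
  rewrite /ball /= (le_lt_trans (almost_additive_ratio vK (ltW e8) K0 _ _))//.
  have := KN _ Nn; have := KN _ (leqnn N).
  by move: (K / N.+1%:R) (K / n.+1%:R) => p q; lra.
exists (limn u) => eps eps0.
have e4 : 0 < eps / 4 by rewrite divr_gt0.
have [K K0 vK] := vaddK _ e4.
exists (K + `|v 0%N|); case=> [|m].
  by rewrite !mulr0 subr0 add0r lerDr.
have [N KN] := small K _ e4.
have lim_le : `|limn u - u m| <= eps + K / m.+1%:R.
  rewrite ler_distl; apply/andP; split.
    apply: limr_ge => //; exists N => // n /= Nn.
    have := almost_additive_ratio vK (ltW e4) K0 m n.
    rewrite -!/(u _) ler_distl; have := KN _ Nn.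
    by move: (K / n.+1%:R) (K / m.+1%:R) => p q; lra.
  apply: limr_le => //; exists N => // n /= Nn.
  have := almost_additive_ratio vK (ltW e4) K0 m n.
  rewrite -!/(u _) ler_distl; have := KN _ Nn.
  by move: (K / n.+1%:R) (K / m.+1%:R) => p q; lra.
have -> : v m.+1 - limn u * m.+1%:R = - (limn u - u m) * m.+1%:R.
  by rewrite /u; field; rewrite gt_eqF.
rewrite normrM normrN (ger0_norm (_ : 0 <= m.+1%:R))//.
rewrite (le_trans (ler_wpM2r _ lim_le))// mulrDl divfK ?gt_eqF// lerD2l.
by rewrite lerDl.
Qed.

End almost_additive_sequences.

(** * Sequences with almost periodic increments *)

(** The tolerance [C] is the same for all window lengths [L], whereas nothing is
    required of the dependence of [l] on [L]. *)
Definition almost_periodic_increments (R : realType) (w : nat -> R) (C : R) :=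
  forall L : nat, exists l : nat, forall a, exists2 b, (b <= l)%N &
    forall k, `|(w (a + k + L)%N - w (a + k)%N) -
                (w (b + k + L)%N - w (b + k)%N)| <= C.

Section almost_periodic_increments.
Variables (R : realType) (w : nat -> R) (C : R).
Hypothesis w_lip : forall k, `|w k.+1 - w k| <= C.

Lemma lipschitz_increment k n : `|w (k + n)%N - w k| <= C * n%:R.
Proof.
elim: n => [|n IHn]; first by rewrite addn0 subrr normr0 mulr0.
have -> : w (k + n.+1)%N - w k =
    (w (k + n).+1 - w (k + n)%N) + (w (k + n)%N - w k).
  by rewrite addnS; ring.
rewrite (le_trans (ler_normD _ _))// -natr1 mulrDr mulr1 addrC.
by rewrite lerD.
Qed.

Let C0 : 0 <= C.
Proof. exact: le_trans (normr_ge0 _) (w_lip 0). Qed.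

(** With S n the sum of the first n values of [w] after [a], both sides are
    equal to S (L + M) - S L - S M. *)
Lemma sum_increments_swap a M L :
  \sum_(k < M) (w (a + k + L)%N - w (a + k)%N) =
  \sum_(i < L) (w (a + i + M)%N - w (a + i)%N).
Proof.
have S m n : \sum_(k < m) w (a + k + n)%N =
    \sum_(k < n + m) w (a + k)%N - \sum_(k < n) w (a + k)%N.
  rewrite big_split_ord/= [X in X - _]addrC addrK.
  by apply: eq_bigr => i _; rewrite -addnA [(i + n)%N]addnC.
by rewrite !sumrB !S (addnC L M); ring.
Qed.

(** After the exchange of the two lengths, each of the [L] summands is an
    increment of length [M] whose starting point is moved by less than [L]. *)
Lemma sum_increments_approx a M L :
  `|L%:R * (w (a + M)%N - w a) -
    \sum_(k < M) (w (a + k + L)%N - w (a + k)%N)| <= L%:R * (2 * C * L%:R).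
Proof.
rewrite sum_increments_swap.
have -> : L%:R * (w (a + M)%N - w a) = \sum_(i < L) (w (a + M)%N - w a).
  by rewrite sumr_const card_ord mulr_natl.
rewrite -sumrB (le_trans (ler_norm_sum _ _ _))//.
have -> : L%:R * (2 * C * L%:R) = \sum_(i < L) (2 * C * L%:R).
  by rewrite sumr_const card_ord mulr_natl.
apply: ler_sum => i _.
have -> : w (a + M)%N - w a - (w (a + i + M)%N - w (a + i)%N) =
    (w (a + i)%N - w a) - (w (a + M + i)%N - w (a + M)%N).
  by rewrite addnAC; ring.
rewrite (le_trans (ler_normB _ _))// (le_trans (lerD (lipschitz_increment _ _)
  (lipschitz_increment _ _)))//.
have iL : i%:R <= L%:R :> R by rewrite ler_nat ltnW.
have := ler_wpM2l C0 iL.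
by lra.
Qed.

(** The family of all windows of length [L] that start in a run of [M] integers
    is moved as a whole by one almost period. This costs [C] for each window,
    but each point of the run is covered [L] times, whence a relative cost of
    [C / L]; the position [b <= l] reached by the move contributes only to the
    constant. *)
Lemma almost_periodic_increments_almost_additive :
  almost_periodic_increments w C -> almost_additive (fun n => w n - w 0%N).
Proof.
move=> wap eps eps0.
pose L := (Num.truncn (C / eps)).+1.
have L0 : 0 < L%:R :> R by [].
have CL : C / L%:R <= eps.
  rewrite ler_pdivrMr// mulrC -ler_pdivrMr//.
  by apply: ltW; rewrite -truncn_le_nat.
have [l lP] := wap L.
exists (4 * C * L%:R + 2 * C * l%:R) => a M.
have [b bl ab] := lP a.
(* The first difference compares positions [a] and [b], which have similar
   windows; the second one compares the close positions [b] and 0. *)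
have -> : w (a + M)%N - w 0%N - (w a - w 0%N) - (w M - w 0%N) =
    ((w (a + M)%N - w a) - (w (b + M)%N - w b)) +
    ((w (M + b)%N - w M) - (w (0 + b)%N - w 0%N)).
  by rewrite add0n (addnC M b); ring.
rewrite (le_trans (ler_normD _ _))// addrA lerD//; last first.
  rewrite (le_trans (ler_normB _ _))// (le_trans (lerD (lipschitz_increment _ _)
    (lipschitz_increment _ _)))//.
  have bl' : b%:R <= l%:R :> R by rewrite ler_nat.
  have := ler_wpM2l C0 bl'.
  by lra.
suff : L%:R * `|(w (a + M)%N - w a) - (w (b + M)%N - w b)| <=
    L%:R * (C / L%:R * M%:R + 4 * C * L%:R).
  rewrite ler_pM2l// => /le_trans; apply.
  by rewrite lerD2r ler_wpM2r.
rewrite -{1}(ger0_norm (ltW L0)) -normrM.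
pose D c := \sum_(k < M) (w (c + k + L)%N - w (c + k)%N).
have -> : L%:R * ((w (a + M)%N - w a) - (w (b + M)%N - w b)) =
  (L%:R * (w (a + M)%N - w a) - D a) - (L%:R * (w (b + M)%N - w b) - D b)
  + (D a - D b) by ring.
have DD : `|D a - D b| <= C * M%:R.
  rewrite -sumrB (le_trans (ler_norm_sum _ _ _))//.
  rewrite mulr_natr -[X in C *+ X]card_ord -sumr_const.
  by apply: ler_sum => i _; exact: ab.
rewrite (le_trans (ler_normD _ _))//.
rewrite (le_trans (lerD (ler_normB _ _) DD))//.
rewrite (le_trans (lerD (lerD (sum_increments_approx _ _ _)
  (sum_increments_approx _ _ _)) (lexx _)))//.
have -> : L%:R * (C / L%:R * M%:R + 4 * C * L%:R) =
    L%:R * (2 * C * L%:R) + L%:R * (2 * C * L%:R) + C * M%:R.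
  by field; rewrite gt_eqF.
exact: lexx.
Qed.

End almost_periodic_increments.

(** * Firing systems and the comparison of their orbits *)

Section firing_systems.
Variables (R : realType) (sigma vs : R).
Hypotheses (sigma0 : 0 <= sigma) (vs0 : 0 < vs).
Implicit Types (F G Phi Psi : R -> R).

(** Abstraction of a leaky integrate-and-fire model: [F] stands for a primitive
    of the weighted input, whose lower bound is the first clause, and [Phi] for
    the firing map. It is stable under translations in time, and different
    inputs can be compared through their primitives. *)
Definition firing_system F Phi : Prop :=
  (forall a b, a <= b -> vs * expR (sigma * a) * (b - a) <= F b - F a) /\
  (forall t, t < Phi t /\ F (Phi t) = F t + expR (sigma * t)).

Lemma primitive_le_reflect F Phi a b :
  firing_system F Phi -> F a <= F b -> a <= b.
Proof.
move=> [Fincr _] Fab; rewrite leNgt; apply/negP => ba.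
have := Fincr _ _ (ltW ba); apply/negP; rewrite -ltNge.
rewrite (@le_lt_trans _ _ 0) ?subr_le0// mulr_gt0 ?subr_gt0//.
by rewrite mulr_gt0// expR_gt0.
Qed.

Lemma primitive_homo F Phi :
  firing_system F Phi -> {homo F : a b / a <= b}.
Proof.
move=> [Fincr _] a b ab; rewrite -subr_ge0 (le_trans _ (Fincr _ _ ab))//.
by rewrite mulr_ge0 ?subr_ge0// mulr_ge0 ?expR_ge0// ltW.
Qed.

Lemma firing_homo F Phi :
  firing_system F Phi -> {homo Phi : a b / a <= b}.
Proof.
move=> FP a b ab; apply: (primitive_le_reflect FP).
rewrite !(FP.2 _).2 lerD ?(primitive_homo FP)// ler_expR.
by rewrite ler_wpM2l.
Qed.

Lemma firing_gap F Phi t : firing_system F Phi -> Phi t <= t + vs^-1.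
Proof.
move=> FP; have := FP.1 _ _ (ltW (FP.2 t).1).
rewrite (FP.2 t).2 [F t + _]addrC addrK mulrAC.
rewrite -[leRHS]mul1r ler_pM2r ?expR_gt0//.
by rewrite mulrC -ler_pdivlMr// div1r lerBlDl.
Qed.

Lemma orbit_homo F Phi n :
  firing_system F Phi -> {homo iter n Phi : a b / a <= b}.
Proof. by move=> FP a b ab; elim: n => //= n; exact: firing_homo FP _ _. Qed.

Lemma orbit_ge F Phi n t : firing_system F Phi -> t <= iter n Phi t.
Proof.
move=> FP; elim: n => //= n IHn.
by rewrite (le_trans IHn)// ltW// (FP.2 _).1.
Qed.

Lemma orbit_le F Phi n t :
  firing_system F Phi -> iter n Phi t <= t + n%:R / vs.
Proof.
move=> FP; elim: n => [|n IHn]; first by rewrite mul0r addr0.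
rewrite iterS (le_trans (firing_gap _ FP))// -natr1 mulrDl div1r addrA.
by rewrite lerD2r.
Qed.

Lemma orbit_primitive_ge F Phi n t : firing_system F Phi ->
  F t + n%:R * expR (sigma * t) <= F (iter n Phi t).
Proof.
move=> FP; elim: n => [|n IHn]; first by rewrite mul0r addr0.
rewrite iterS (FP.2 _).2 -natr1 mulrDl mul1r addrA lerD// ler_expR.
by rewrite ler_wpM2l// (orbit_ge _ _ FP).
Qed.

(** A change of the input by at most [eps] in S^1-norm changes its integral
    over [a, b] by at most [eps * (b - a + 1)], and the weight is at most
    [expR (sigma * b)] there. *)
Definition close_primitives eps F G : Prop := forall a b, a <= b ->
  (G b - G a) - (F b - F a) <= expR (sigma * b) * eps * (b - a + 1) /\
  (F b - F a) - (G b - G a) <= expR (sigma * b) * eps * (b - a + 1).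

Lemma close_primitives_sym eps F G :
  close_primitives eps F G -> close_primitives eps G F.
Proof. by move=> FG a b /FG[]. Qed.

(** The orbit of [Psi] is compared with the orbit of [Phi] that is one firing
    ahead. Since [expR (sigma * _)] is nondecreasing, [Phi] does not decrease
    the distance between two points measured by [F]. So the initial lead
    [expR (sigma * t)] is only consumed by the error made when [F] replaces [G]
    at each of the [m] steps, and [eps] is chosen to make these errors sum up to
    at most this lead. *)
Lemma orbit_comparison m : exists2 eps, 0 < eps & forall F G Phi Psi t n,
  firing_system F Phi -> firing_system G Psi -> close_primitives eps F G ->
  (n <= m)%N -> iter n Psi t <= iter n.+1 Phi t.
Proof.
(* Relative to [eps * expR (sigma * t)], [c] bounds the error of one step: a gap
   is at most [vs^-1] and the first [m] firings occur before [t + m / vs]. *)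
pose c := (vs^-1 + 1) * expR (sigma * (m%:R / vs)).
have c0 : 0 < c by rewrite mulr_gt0 ?expR_gt0// addr_gt0 ?invr_gt0.
exists (m.+1%:R * c)^-1; first by rewrite invr_gt0 mulr_gt0.
set eps := _^-1 => F G Phi Psi t n FP GP FG.
have eps0 : 0 < eps by rewrite invr_gt0 mulr_gt0.
pose err := eps * c * expR (sigma * t).
have errm k : (k <= m)%N -> k%:R * err <= expR (sigma * t).
  move=> km; rewrite /err mulrA -[leRHS]mul1r ler_pM2r ?expR_gt0//.
  rewrite mulrCA /eps invfM mulrACA mulVf ?gt_eqF// mulr1.
  by rewrite mulrC ler_pdivrMr// mul1r ler_nat ltnW.
suff main : (n <= m)%N -> F (iter n Psi t) <=
    F (iter n.+1 Phi t) - expR (sigma * t) + n%:R * err.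
  move=> nm; apply: (primitive_le_reflect FP).
  by rewrite (le_trans (main nm))//; have := errm _ nm; lra.
elim: n => [_|n IHn nm]; first by rewrite mul0r addr0 /= (FP.2 t).2 addrK.
have {}IHn := IHn (ltnW nm).
have yx : iter n Psi t <= iter n.+1 Phi t.
  by apply: (primitive_le_reflect FP); have := errm _ (ltnW nm); lra.
rewrite [iter n.+2 _ _]iterS [in leLHS]iterS (FP.2 _).2.
set y := iter n Psi t in IHn yx *; set x := iter n.+1 Phi t in IHn yx *.
have y_le : Psi y <= t + m%:R / vs.
  rewrite -[Psi y]/(iter n.+1 Psi t) (le_trans (orbit_le _ _ GP))// lerD2l.
  by rewrite ler_wpM2r ?invr_ge0 ?ler_nat// ltW.
have step : (F (Psi y) - F y) - (G (Psi y) - G y) <= err.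
  apply: (le_trans (FG _ _ (ltW (GP.2 y).1)).2).
  rewrite /err /c [leRHS](_ : _ = expR (sigma * (t + m%:R / vs)) * eps *
    (vs^-1 + 1)); last by rewrite [sigma * (_ + _)]mulrDr expRD; ring.
  have gap : Psi y - y + 1 <= vs^-1 + 1.
    by rewrite lerD2r lerBlDl (firing_gap _ GP).
  apply: ler_pM => //.
  - by rewrite mulr_ge0 ?expR_ge0// ltW.
  - by rewrite addr_ge0// subr_ge0 ltW// (GP.2 y).1.
  - by rewrite ler_pM2r// ler_expR ler_wpM2l.
have : expR (sigma * y) <= expR (sigma * x) by rewrite ler_expR ler_wpM2l.
move: step; rewrite (GP.2 y).2 -natr1 mulrDl mul1r; lra.
Qed.

End firing_systems.

(** * Almost periodicity of the orbits *)

Section almost_periodic_firing.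
Variables (R : realType) (sigma vs : R).
Hypotheses (sigma0 : 0 <= sigma) (vs0 : 0 < vs).

(** The primitive of the translated input: the substitution [u + tau] in the
    integral of the weighted input produces the weight
    [expR (sigma * u) * expR (sigma * tau)]. *)
Definition translate_primitive (tau : R) (F : R -> R) (s : R) : R :=
  expR (- (sigma * tau)) * F (s + tau).

Definition almost_periodic_primitive (F : R -> R) : Prop :=
  forall eps, 0 < eps -> relatively_dense
    [set tau | close_primitives sigma eps F (translate_primitive tau F)].

Variables F Phi : R -> R.
Hypothesis FP : firing_system sigma vs F Phi.
Hypothesis Fap : almost_periodic_primitive F.

Lemma translate_firing_system tau :
  firing_system sigma vs (translate_primitive tau F)
    (fun t => Phi (t + tau) - tau).
Proof.
have E a : expR (sigma * (a + tau)) = expR (sigma * tau) * expR (sigma * a).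
  by rewrite mulrDr expRD mulrC.
split=> [a b ab|t].
  rewrite /translate_primitive -mulrBr expRN [leRHS]mulrC.
  rewrite ler_pdivlMr ?expR_gt0//.
  have -> : vs * expR (sigma * a) * (b - a) * expR (sigma * tau) =
      vs * expR (sigma * (a + tau)) * (b + tau - (a + tau)) by rewrite E; ring.
  by apply: FP.1; rewrite lerD2r.
rewrite ltrBrDr; split; first exact: (FP.2 _).1.
rewrite /translate_primitive subrK (FP.2 _).2 E mulrDr mulrA expRN.
by rewrite mulVf ?mul1r// gt_eqF// expR_gt0.
Qed.

Lemma orbit_translate tau n t :
  iter n (fun t => Phi (t + tau) - tau) t = iter n Phi (t + tau) - tau.
Proof. by elim: n => [|n IHn]; rewrite ?addrK//= IHn subrK. Qed.

(** For an almost period [tau] whose quality depends on [m], orbits started at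
    [t] and at [t + tau] interlace for [m] firings once [tau] is subtracted. *)
Lemma orbit_almost_periodic m : relatively_dense
  [set tau | forall t n, (n <= m)%N ->
     iter n Phi (t + tau) - tau <= iter n.+1 Phi t /\
     iter n Phi t <= iter n.+1 Phi (t + tau) - tau].
Proof.
have [eps eps0 cmp] := orbit_comparison sigma0 vs0 m.
have [l l0 lP] := Fap eps0; exists l => // x.
have [tau [tauP taux]] := lP x; exists tau; split=> // t n nm.
have FtP := translate_firing_system tau.
rewrite -(orbit_translate tau n) -(orbit_translate tau n.+1); split.
  exact: (cmp _ _ _ _ t n FP FtP tauP nm).
exact: (cmp _ _ _ _ t n FtP FP (close_primitives_sym tauP) nm).
Qed.

(** Each firing after [s] increases [F] by at least [expR (sigma * s)], while
    the growth of [F] over [s, s + 1] is comparable, up to an almost period, to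
    its growth over a unit interval contained in [0, l + 1]. *)
Lemma firing_count_bounded : exists C, forall s, s + 1 < iter C Phi s.
Proof.
have [l l0 lP] := Fap ltr01.
pose B := F (l + 1) - F 0 + 2 * expR sigma.
have [N BN] : exists N : nat, B < N%:R.
  by exists (Num.truncn B).+1; rewrite -truncn_le_nat.
exists N => s.
have [tau [tauP]] := lP (- s).
rewrite /= in_itv/= => /andP[stau taul].
rewrite ltNge; apply/negP => itle.
have := orbit_primitive_ge sigma0 N s FP.
have Fit := primitive_homo vs0 FP itle.
have s1 : s <= s + 1 by rewrite lerDl.
have [_ +] := tauP _ _ s1.
rewrite /translate_primitive -mulrBr.
have -> : s + 1 - s + 1 = 2 by ring.
have -> : expR (sigma * (s + 1)) = expR (sigma * s) * expR sigma.
  by rewrite mulrDr mulr1 expRD.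
have Fl : F (s + 1 + tau) - F (s + tau) <= F (l + 1) - F 0.
  apply: lerB; apply: (primitive_homo vs0 FP); lra.
have Fl0 : 0 <= F (s + 1 + tau) - F (s + tau).
  by rewrite subr_ge0; apply: (primitive_homo vs0 FP); lra.
have etau : expR (- (sigma * tau)) <= expR (sigma * s).
  rewrite ler_expR -mulrN ler_wpM2l//; lra.
have := ler_pM (expR_ge0 _) Fl0 etau Fl.
have := expR_gt0 (sigma * s) => es0.
have : B * expR (sigma * s) < N%:R * expR (sigma * s) by rewrite ltr_pM2r.
by rewrite /B; lra.
Qed.

End almost_periodic_firing.

(** * Counting the points of an orbit *)

(** The convergence of [n / x n] to [rho], in a form that allows [x n] to vanish
    and that is preserved by interlacing. *)
Definition orbit_asymptotics (R : realType) (x : nat -> R) (rho : R) : Prop :=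
  forall eps, 0 < eps ->
    exists K, forall n, `|n%:R - rho * x n| <= eps * n%:R + K.

Section orbit_counting.
Variables (R : realType) (sigma vs : R) (F Phi : R -> R).
Hypotheses (sigma0 : 0 <= sigma) (vs0 : 0 < vs).
Hypothesis FP : firing_system sigma vs F Phi.
Variable C : nat.
Hypothesis PhiC : forall s : R, s + 1 < iter C Phi s.
Variable t0 : R.
Local Notation x n := (iter n Phi t0).

Lemma orbit_unbounded s : exists n, s < x n.
Proof.
have grow k : t0 + k%:R <= x (k * C).
  elim: k => [|k IHk]; first by rewrite addr0.
  rewrite mulSn iterD -natr1 addrA (le_trans _ (ltW (PhiC _)))//.
  by rewrite lerD2r.
exists ((Num.truncn (s - t0)).+1 * C)%N.
by rewrite (lt_le_trans _ (grow _))// -ltrBlDl -truncn_le_nat.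
Qed.

(** The number of points of the orbit up to time [s], as the index of the first
    later point. *)
Definition orbit_count s := ex_minn (orbit_unbounded s).

Lemma orbit_ndecr m n : (m <= n)%N -> x m <= x n.
Proof.
move=> /subnK <-; rewrite iterD; exact: orbit_ge FP.
Qed.

Lemma ltn_orbit_count n s : (n < orbit_count s)%N = (x n <= s).
Proof.
rewrite /orbit_count; case: ex_minnP => m sm mmin.
apply/idP/idP => [nm|ns].
  by rewrite leNgt; apply: contraL nm => /mmin; rewrite -leqNgt.
rewrite ltnNge; apply: contraL ns => /orbit_ndecr mn.
by rewrite -ltNge (lt_le_trans sm).
Qed.

Lemma orbit_count_homo : {homo orbit_count : a b / a <= b >-> (a <= b)%N}.
Proof.
move=> a b ab; case ka: (orbit_count a) => [//|k].
rewrite ltn_orbit_count (le_trans _ ab)%R// -ltn_orbit_count ka; exact: leqnn.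
Qed.

Lemma orbit_count_lt s : s < x (orbit_count s).
Proof. by rewrite ltNge -ltn_orbit_count ltnn. Qed.

Lemma orbit_count_lip (s : R) n :
  (orbit_count (s + n%:R)%R <= orbit_count s + C * n)%N.
Proof.
elim: n => [|n IHn]; first by rewrite muln0 addn0 addr0.
rewrite mulnS [(C + _)%N]addnC addnA.
rewrite -natr1 addrA; apply: leq_trans (leq_add IHn (leqnn C)).
rewrite leqNgt ltn_orbit_count -ltNge addnC iterD.
rewrite (lt_le_trans (PhiC _))// (orbit_homo sigma0 vs0 _ FP)//.
by rewrite ltW// orbit_count_lt.
Qed.

Lemma orbit_count_lip1 (s : R) :
  (orbit_count (s + 1)%R <= orbit_count s + C)%N.
Proof. by have := orbit_count_lip s 1; rewrite muln1. Qed.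

(** An orbit started inside the window at [s'] leaves it at the same time as the
    orbit of [t0], up to one firing. The hypothesis transports it to the window
    at [s], where it is again one firing away from the orbit of [t0]. *)
Lemma orbit_count_compare (s s' : R) L : t0 <= s' ->
  (forall n, (n <= (C * L).+1)%N ->
     iter n Phi s' - s' <= iter n.+1 Phi s - s) ->
  (orbit_count (s + L%:R)%R + orbit_count s' <=
   orbit_count (s' + L%:R)%R + orbit_count s + 2)%N.
Proof.
move=> t0s' near_orbit.
have : (0 < orbit_count s')%N by rewrite ltn_orbit_count.
case def_p : (orbit_count s') => [//|p] _.
have s's'L : s' <= s' + L%:R by rewrite lerDl.
have := orbit_count_homo s's'L; have := orbit_count_lip s' L.
rewrite def_p => q_le /subnKC; set q := (_ - _)%N => def_q.
have qCL : (q <= C * L)%N by rewrite -(leq_add2l p.+1) def_q.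
(* [s'] is not earlier than the last point [x p] of the orbit up to [s']. *)
have s'L_lt : s' + L%:R < iter q.+1 Phi s'.
  apply: (@lt_le_trans _ _ (x (q.+1 + p))).
    by rewrite addSnnS addnC def_q orbit_count_lt.
  rewrite iterD (orbit_homo sigma0 vs0 _ FP)//.
  by rewrite -ltn_orbit_count def_p.
have sL_lt : s + L%:R < x (q.+2 + orbit_count s).
  have near_q := near_orbit q.+1 qCL.
  apply: (@lt_le_trans _ _ (iter q.+2 Phi s)); first by lra.
  by rewrite iterD (orbit_homo sigma0 vs0 _ FP)// ltW// orbit_count_lt.
have : (orbit_count (s + L%:R)%R <= q.+2 + orbit_count s)%N.
  by rewrite leqNgt ltn_orbit_count -ltNge.
by rewrite -def_q; lia.
Qed.

(** An almost period moves an integer to a real number [c] of [0, l]. Rounding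
    [c] to an integer costs [C], the comparison of the windows costs 2. *)
Lemma orbit_count_almost_periodic :
  almost_periodic_primitive sigma F ->
  almost_periodic_increments (fun k => (orbit_count (t0 + k%:R)%R)%:R : R)
    (C + 2)%:R.
Proof.
move=> Fap L.
have [l l0 lP] := orbit_almost_periodic sigma0 vs0 FP Fap (C * L).+1.
exists (Num.truncn l) => a; have [tau [tauP]] := lP (- a%:R).
rewrite /= in_itv/= => /andP[tau_gt tau_lt].
pose c := a%:R + tau.
have c0 : 0 <= c by rewrite /c; lra.
have cl : c <= l by rewrite /c; lra.
exists (Num.truncn c); first exact: le_truncn.
move=> k; set b := Num.truncn c.
have [bc cb] : b%:R <= c /\ c < b.+1%:R.
  by apply/andP; exact: truncn_itv.
rewrite !natrD !addrA.
set s := t0 + a%:R + k%:R; set r := t0 + b%:R + k%:R; set s' := s + tau.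
have rs' : r <= s' by rewrite /r /s' /s; move: bc; rewrite /c; lra.
have s'r : s' <= r + 1.
  by rewrite /r /s' /s; move: cb; rewrite /c -natr1; lra.
have t0s : t0 <= s by rewrite /s -addrA lerDl addr_ge0.
have t0s' : t0 <= s' by rewrite (le_trans _ rs')// /r -addrA lerDl addr_ge0.
have s's : s' = s + tau by [].
have c1 : (orbit_count (s + L%:R)%R + orbit_count s' <=
   orbit_count (s' + L%:R)%R + orbit_count s + 2)%N.
  by apply: orbit_count_compare => // n /(tauP s)[+ _]; rewrite -/s'; lra.
have c2 : (orbit_count (s' + L%:R)%R + orbit_count s <=
   orbit_count (s + L%:R)%R + orbit_count s' + 2)%N.
  by apply: orbit_count_compare => // n /(tauP s)[_ +]; rewrite -/s'; lra.
have d1 := orbit_count_homo rs'.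
have d2 : (orbit_count s' <= orbit_count r + C)%N.
  by rewrite (leq_trans (orbit_count_homo s'r))// orbit_count_lip1.
have e1 : (orbit_count (r + L%:R)%R <= orbit_count (s' + L%:R)%R)%N.
  by rewrite orbit_count_homo// lerD2r.
have e2 : (orbit_count (s' + L%:R)%R <= orbit_count (r + L%:R)%R + C)%N.
  rewrite (leq_trans _ (orbit_count_lip1 _))//.
  by apply: orbit_count_homo; rewrite [leRHS]addrAC lerD2r.
move: c1 c2 d1 d2 e1 e2; rewrite -!(ler_nat R) !natrD.
by move=> *; rewrite ler_norml; apply/andP; split; lra.
Qed.

Lemma orbit_count_rate : almost_periodic_primitive sigma F ->
  exists rho, sublinear_error
    (fun k => (orbit_count (t0 + k%:R)%R)%:R : R) rho.
Proof.
move=> Fap; set w := fun k : nat => _.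
have w_lip k : `|w k.+1 - w k| <= (C + 2)%:R.
  have kk : t0 + k%:R <= t0 + k.+1%:R by rewrite lerD2l ler_nat.
  rewrite ger0_norm ?subr_ge0 ?ler_nat ?orbit_count_homo//.
  rewrite lerBlDl -natrD ler_nat -natr1 addrA.
  rewrite (leq_trans (orbit_count_lip1 _))//.
  by rewrite leq_add2l leq_addr.
have [rho rhoP] := almost_additive_rate
  (almost_periodic_increments_almost_additive w_lip
    (orbit_count_almost_periodic Fap)).
exists rho => eps /rhoP[K KP]; exists (K + `|w 0%N|) => n.
have -> : w n - rho * n%:R = (w n - w 0%N - rho * n%:R) + w 0%N by ring.
by rewrite (le_trans (ler_normD _ _))// addrA lerD.
Qed.

(** The integer [k] just below [x n - t0] counts about [n] points of the
    orbit. *)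
Lemma orbit_rate : almost_periodic_primitive sigma F ->
  exists rho, orbit_asymptotics (fun n => x n) rho.
Proof.
move=> /orbit_count_rate[rho rhoP]; exists rho => eps eps0.
(* Gaps are at most [vs^-1], so [k <= n / vs] for the integer [k] below. *)
have [|K KP] := rhoP (eps * vs); first exact: mulr_gt0.
exists ((C + 1)%:R + K + `|rho| * (1 + `|t0|)) => n.
pose k := Num.truncn (x n - t0).
have x0 : 0 <= x n - t0 by rewrite subr_ge0 (orbit_ge _ _ FP).
have [kx xk] : k%:R <= x n - t0 /\ x n - t0 < k.+1%:R.
  by apply/andP; exact: truncn_itv.
have cn : (orbit_count (t0 + k%:R)%R <= n + 1)%N.
  rewrite leqNgt ltn_orbit_count -ltNge addn1.
  rewrite (@le_lt_trans _ _ (x n))//; first lra.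
  exact: (FP.2 _).1.
have nc : (n <= orbit_count (t0 + k%:R)%R + C)%N.
  rewrite (leq_trans _ (orbit_count_lip1 _))//.
  by rewrite ltnW// ltn_orbit_count; move: xk; rewrite -natr1; lra.
set ck : R := (orbit_count (t0 + k%:R)%R)%:R.
have A : `|n%:R - ck| <= (C + 1)%:R.
  move: cn nc; rewrite -!(ler_nat R) !natrD -/ck => cn nc.
  have C0 : 0 <= C%:R :> R by [].
  by rewrite ler_norml; apply/andP; split; lra.
have kn : eps * vs * k%:R <= eps * n%:R.
  rewrite -mulrA ler_pM2l// mulrC -ler_pdivlMr//.
  by rewrite (le_trans kx)// lerBlDl (orbit_le vs0 _ _ FP).
have D : `|rho * (k%:R - x n)| <= `|rho| * (1 + `|t0|).
  rewrite normrM ler_wpM2l//.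
  have -> : k%:R - x n = (k%:R - (x n - t0)) - t0 by ring.
  rewrite (le_trans (ler_normB _ _))// lerD2r ler_norml.
  by move: xk; rewrite -natr1 => xk; apply/andP; split; lra.
have -> : n%:R - rho * x n =
  (n%:R - ck) + (ck - rho * k%:R) + rho * (k%:R - x n) by ring.
rewrite (le_trans (ler_normD _ _))// [leRHS]addrA lerD//.
rewrite (le_trans (ler_normD _ _))// (le_trans (lerD A (KP k)))//.
by lra.
Qed.

End orbit_counting.

(** * Existence and uniqueness of the rate of a firing system *)

Section orbit_asymptotics.
Variable R : realType.

Lemma nat_not_bounded (K : R) : (forall n, n%:R <= K) -> False.
Proof.
move=> /(_ (Num.truncn K).+1); apply/negP.
by rewrite -ltNge -truncn_le_nat.
Qed.

Lemma orbit_asymptotics_gt0 (x : nat -> R) rho t :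
  (forall n, t <= x n) -> orbit_asymptotics x rho -> 0 < rho.
Proof.
move=> tx asx; have h0 : 0 < 2^-1 :> R by rewrite invr_gt0.
rewrite ltNge; apply/negP => rho0.
have [K KP] := asx _ h0; apply: (@nat_not_bounded (2 * (K + rho * t))) => n.
have := KP n; rewrite ler_norml => /andP[_].
have := ler_wnM2l rho0 (tx n); lra.
Qed.

(** The estimate with slope 1/4 gives [x n >= n / (2 * rho)] eventually, after
    which the division of the estimate with a small slope by [x n] is
    harmless. *)
Lemma orbit_asymptotics_cvg (x : nat -> R) rho : 0 < rho ->
  orbit_asymptotics x rho -> (fun n => n%:R / x n) @ \oo --> rho.
Proof.
move=> rho0 asx; apply/cvgrPdist_lt => e e0.
have [|K1 K1P] := asx (1 / 4); first by rewrite divr_gt0.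
have [|K2 K2P] := asx (e / (4 * rho)); first by rewrite divr_gt0// mulr_gt0.
have [N NP] : exists N : nat, forall n, (N <= n)%N ->
    4 * K1 < n%:R /\ 4 * rho * K2 / e < n%:R.
  exists (Num.truncn (4 * K1) + Num.truncn (4 * rho * K2 / e)).+1 => n Nn.
  have lt_n (y : R) : (Num.truncn y < n)%N -> y < n%:R.
    move=> yn; apply: (@lt_le_trans _ _ (Num.truncn y).+1%:R).
      by rewrite -truncn_le_nat.
    by rewrite ler_nat.
  split; apply: lt_n; apply: leq_trans Nn; rewrite ltnS.
    exact: leq_addr.
  exact: leq_addl.
exists N => // n /= /NP[n1 n2].
move: (K1P n) (K2P n); rewrite ler_norml => /andP[_ A] B.
have {A}xn : n%:R / (2 * rho) < x n.
  have := ler0n R n; rewrite ltr_pdivrMr ?mulr_gt0//; lra.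
have x0 : 0 < x n by rewrite (le_lt_trans _ xn)// divr_ge0// mulr_ge0// ltW.
have -> : rho - n%:R / x n = - (n%:R - rho * x n) / x n.
  by field; rewrite gt_eqF.
rewrite normrM normrN normfV (gtr0_norm x0) ltr_pdivrMr//.
apply: (le_lt_trans B).
rewrite (@le_lt_trans _ _ (e * (n%:R / (2 * rho))))//; last by rewrite ltr_pM2l.
have : K2 <= e / (4 * rho) * n%:R.
  rewrite ltW// -mulrA [_^-1 * _]mulrC -(ltr_pdivrMl _ _ e0).
  rewrite ltr_pdivlMr ?mulr_gt0//; move: n2; congr (_ < _).
  by field; rewrite gt_eqF.
have -> : e * (n%:R / (2 * rho)) = e / (4 * rho) * n%:R + e / (4 * rho) * n%:R.
  by field; rewrite gt_eqF.
by rewrite lerD2l.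
Qed.

Lemma orbit_asymptotics_interleaved (x y : nat -> R) k rho : 0 < rho ->
  (forall n, x n <= y n <= x (n + k)%N) ->
  orbit_asymptotics x rho -> orbit_asymptotics y rho.
Proof.
move=> rho0 xyx asx eps eps0; have [K KP] := asx _ eps0.
exists (K + k%:R + eps * k%:R) => n; have /andP[xy yx] := xyx n.
have := ler_wpM2l (ltW rho0) xy; have := ler_wpM2l (ltW rho0) yx.
have : 0 <= k%:R :> R by [].
have : 0 <= eps * k%:R by rewrite mulr_ge0// ltW.
have := KP n; have := KP (n + k)%N; rewrite !natrD !ler_norml.
by move=> /andP[A B] /andP[D E] *; apply/andP; split; lra.
Qed.

End orbit_asymptotics.

Section system_rate.
Variables (R : realType) (sigma vs : R) (F Phi : R -> R).
Hypotheses (sigma0 : 0 <= sigma) (vs0 : 0 < vs).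
Hypothesis FP : firing_system sigma vs F Phi.
Hypothesis Fap : almost_periodic_primitive sigma F.

(** The rates at two times are compared through the earlier one, whose orbit
    overtakes the later time after finitely many firings. *)
Lemma firing_system_rate : exists2 rho : R, 0 < rho & forall t,
  (fun n => n%:R / iter n Phi t) @ \oo --> rho.
Proof.
have [C PhiC] := firing_count_bounded sigma0 vs0 FP Fap.
have asympt t : exists2 rho : R, 0 < rho &
    orbit_asymptotics (fun n => iter n Phi t) rho.
  have [rho rhoP] := orbit_rate sigma0 vs0 FP PhiC t Fap.
  exists rho => //; apply: (orbit_asymptotics_gt0 (t := t) _ rhoP) => n.
  exact: orbit_ge FP.
have later t t' rho : 0 < rho -> t <= t' ->
    orbit_asymptotics (fun n => iter n Phi t) rho ->
    (fun n => n%:R / iter n Phi t') @ \oo --> rho.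
  move=> rho0 tt' ast; apply: orbit_asymptotics_cvg => //.
  have [k kP] := orbit_unbounded PhiC t t'.
  apply: (orbit_asymptotics_interleaved (k := k) rho0 _ ast) => n.
  by rewrite iterD !(orbit_homo sigma0 vs0 _ FP)// ltW.
have [rho rho0 rhoP] := asympt 0.
exists rho => // t.
have [rho' rho'0 rho'P] := asympt (Num.min t 0).
have -> : rho = rho'.
  apply: (cvg_unique _ (later _ _ _ rho0 (lexx 0) rhoP)) => //.
  by apply: later rho'P => //; rewrite ge_min lexx orbT.
by apply: later rho'P => //; rewrite ge_min lexx.
Qed.

End system_rate.

(** * Integrals over intervals and translations *)

Section translation_invariance.
Variables (R : realType) (tau : R).
Local Notation mu := (@lebesgue_measure R).

Lemma measurable_shift : measurable_fun [set: measurableTypeR R]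
  (shift tau : measurableTypeR R -> measurableTypeR R).
Proof. exact: measurable_funD. Qed.

Lemma preimage_shift_itvcc a b :
  shift tau @^-1` `[a + tau, b + tau] = `[a, b]%classic.
Proof.
by apply/seteqP; split => u /=; rewrite !in_itv/= !lerD2r.
Qed.

Lemma lebesgue_measure_shift (A : set R) : measurable A ->
  pushforward mu (shift tau : measurableTypeR R -> measurableTypeR R) A = mu A.
Proof.
move=> mA; apply/esym/lebesgue_measure_unique => //= [|mshift];
  first exact: measurable_funD.
move=> _ [[a b]] _ <-.
rewrite /pushforward.
have -> : shift tau @^-1` `]a, b] = `]a - tau, b - tau]%classic.
  by apply/seteqP; split => u /=; rewrite !in_itv/= ltrBlDr lerBrDr.
rewrite !lebesgue_measure_itv/= !lte_fin ltrD2r -!EFinB.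
by have -> : b - tau - (a - tau) = b - a by ring.
Qed.

Lemma ge0_integral_shift (h : R -> \bar R) a b :
  measurable_fun [set: R] h -> (forall u, (0 <= h u)%E) ->
  (\int[mu]_(u in `[(a + tau)%R, (b + tau)%R]) h u =
   \int[mu]_(u in `[a, b]) h (u + tau)%R)%E.
Proof.
move=> mh h0; apply/esym; rewrite -(preimage_shift_itvcc a b).
apply: etrans (esym (ge0_integral_pushforward measurable_shift mu _ _ _)) _.
- by [].
- exact: measurable_funS mh.
- by [].
apply: eq_measure_integral => [|mshift A mA _]; first exact: measurable_shift.
exact: lebesgue_measure_shift.
Qed.

Lemma Rintegral_shift (h : R -> R) a b : measurable_fun [set: R] h ->
  mu.-integrable `[a, b] (EFin \o (h \o shift tau)) ->
  \int[mu]_(u in `[(a + tau)%R, (b + tau)%R]) h u =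
  \int[mu]_(u in `[a, b]) h (u + tau).
Proof.
move=> mh; rewrite -(preimage_shift_itvcc a b) => ih; rewrite /Rintegral.
have mEh : measurable_fun [set: R] (EFin \o h) by exact/measurable_EFinP.
congr (fine _); apply/esym.
apply: etrans (esym (integral_pushforward measurable_shift mEh ih _)) _.
  by [].
apply: eq_measure_integral => [|mshift A mA _]; first exact: measurable_shift.
exact: lebesgue_measure_shift.
Qed.

End translation_invariance.

Section local_integrals.
Variable R : realType.
Local Notation mu := (@lebesgue_measure R).
Implicit Types h : R -> R.

Lemma locally_integrable_itv h a b : locally_integrable [set: R] h ->
  mu.-integrable `[a, b] (EFin \o h).
Proof.
move=> [mh _ hK]; apply/integrableP; split.
  by apply/measurable_EFinP; exact: measurable_funS mh.
by apply: hK => //; exact: segment_compact.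
Qed.

Lemma locally_integrable_shift h tau : locally_integrable [set: R] h ->
  locally_integrable [set: R] (h \o shift tau).
Proof.
move=> lh; have [mh _ hK] := lh; split.
- exact: measurableT_comp mh (measurable_shift tau).
- exact: openT.
move=> K _ cK; have [M [Mr MK]] := compact_bounded cK.
have KM : K `<=` `[- (`|M| + 1), `|M| + 1]%classic.
  move=> u /(MK (`|M| + 1)); rewrite /= in_itv/= -ler_norml; apply.
  by rewrite (le_lt_trans (ler_norm _))// ltrDl.
have mhT : measurable_fun [set: R] (fun u => `|h (u + tau)|%:E).
  apply/measurable_EFinP; apply: measurableT_comp => //.
  exact: measurableT_comp mh (measurable_shift tau).
apply: (@le_lt_trans _ _ (\int[mu]_(u in `[(- (`|M| + 1))%R, (`|M| + 1)%R])
    `|h (u + tau)|%:E)%E).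
  apply: ge0_subset_integral => //; first exact: compact_measurable.
  exact: measurable_funS mhT.
rewrite -(ge0_integral_shift tau (h := fun u => `|h u|%:E))//.
  by apply: hK => //; exact: segment_compact.
by apply/measurable_EFinP; apply: measurableT_comp.
Qed.

Lemma Rintegral_itv_chasles h a b c : a <= b -> b <= c ->
  mu.-integrable `[a, c] (EFin \o h) ->
  \int[mu]_(u in `[a, c]) h u =
  \int[mu]_(u in `[a, b]) h u + \int[mu]_(u in `[b, c]) h u.
Proof.
move=> ab bc ih.
have := Rintegral_itvB (x := b) ih; rewrite !bnd_simp => /(_ ab bc).
rewrite Rintegral_itv_obnd_cbnd; last first.
  by apply: integrableS ih => //; apply: subset_itvr; rewrite bnd_simp.
by move=> <-; rewrite addrC subrK.
Qed.

(** The two branches are needed for a single [F] to serve all initial times,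
    negative ones included. *)
Lemma integral_primitive h :
  (forall a b, mu.-integrable `[a, b] (EFin \o h)) ->
  exists F : R -> R, forall a b, a <= b ->
    F b - F a = \int[mu]_(u in `[a, b]) h u.
Proof.
move=> ih.
exists (fun s => if 0 <= s then \int[mu]_(u in `[0, s]) h u
                 else - \int[mu]_(u in `[s, 0]) h u) => a b ab.
case: ifPn => b0; case: ifPn => a0.
- by rewrite (Rintegral_itv_chasles a0 ab)// addrC addKr.
- rewrite -ltNge in a0.
  by rewrite (Rintegral_itv_chasles (ltW a0) b0)// opprK addrC.
- by move: b0; rewrite (le_trans a0 ab).
- rewrite -!ltNge in a0 b0.
  by rewrite (Rintegral_itv_chasles ab (ltW b0))// opprK addrC addrK.
Qed.

Lemma ae_le_Rintegral (D : set R) (h1 h2 : R -> R) : measurable D ->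
  mu.-integrable D (EFin \o h1) -> mu.-integrable D (EFin \o h2) ->
  {ae mu, forall u, D u -> h1 u <= h2 u} ->
  \int[mu]_(u in D) h1 u <= \int[mu]_(u in D) h2 u.
Proof.
move=> mD ih1 ih2 h12; rewrite -subr_ge0 -RintegralB//.
have mh : measurable_fun D (fun u => h2 u - h1 u).
  by apply: measurable_funB; apply/measurable_EFinP;
    [case/integrableP: ih2|case/integrableP: ih1].
suff -> : \int[mu]_(u in D) (h2 u - h1 u) = \int[mu]_(u in D) `|h2 u - h1 u|.
  exact: Rintegral_ge0.
congr fine; apply: ae_eq_integral => //.
- exact/measurable_EFinP.
- by apply/measurable_EFinP; exact: measurableT_comp.
- case: h12 => N [mN N0 hN]; exists N; split => //.
  apply: subset_trans hN => u /=; apply: contra_not => h12 Du.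
  by rewrite ger0_norm// subr_ge0 h12.
Qed.

Lemma Rintegral_itv_cst (c a b : R) : a <= b ->
  \int[mu]_(u in `[a, b]) c = c * (b - a).
Proof.
move=> ab; rewrite Rintegral_cst//; congr (_ * _).
have mu_itv : mu `[a, b]%classic = (b - a)%:E.
  rewrite lebesgue_measure_itv/= lte_fin.
  by case: ltgtP ab => // -> _; rewrite subrr.
by rewrite /= mu_itv.
Qed.

End local_integrals.

(** * The leaky integrate-and-fire model as a firing system *)

Section weighted_integrals.
Variables (R : realType) (sigma : R).
Hypothesis sigma0 : 0 <= sigma.
Local Notation mu := (@lebesgue_measure R).
Local Notation weight u := (expR (sigma * u)).
Implicit Types g : R -> R.

Lemma continuous_weight : continuous (fun u : R => weight u).
Proof.
move=> u; apply: (continuous_comp (f := fun u => sigma * u) (g := expR)).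
  exact: mulrl_continuous.
exact: continuous_expR.
Qed.

Lemma integrable_itv_cst (c a b : R) : mu.-integrable `[a, b] (EFin \o cst c).
Proof.
apply: continuous_compact_integrable; first exact: segment_compact.
by apply/continuous_subspaceT => u; exact: cvg_cst.
Qed.

Lemma integrable_weighted g a b : mu.-integrable `[a, b] (EFin \o g) ->
  mu.-integrable `[a, b] (EFin \o (fun u => g u * weight u)).
Proof.
move=> ig.
have -> : EFin \o (fun u => g u * weight u) =
    ((EFin \o (fun u => weight u)) \* (EFin \o g))%E.
  by apply/funext => u /=; rewrite mulrC EFinM.
apply: integrableMr => //.
  apply: measurable_funTS; apply: continuous_measurable_fun.
  exact: continuous_weight.
exists (weight b); split; first exact: num_real.
move=> M bM u /=; rewrite in_itv/= => /andP[_ ub].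
rewrite ger0_norm ?expR_ge0// (le_trans _ (ltW bM))// ler_expR.
by rewrite ler_wpM2l.
Qed.

Lemma integrable_forced_weight g a b : locally_integrable [set: R] g ->
  mu.-integrable `[a, b] (EFin \o (fun u => (g u - sigma) * weight u)).
Proof.
move=> lg; apply: integrable_weighted.
have -> : EFin \o (fun u => g u - sigma) =
    ((EFin \o g) \- (EFin \o cst sigma))%E.
  by apply/funext => u /=; rewrite EFinB.
apply: integrableB => //; last exact: integrable_itv_cst.
exact: locally_integrable_itv.
Qed.

Lemma normr_weighted_le g a b : mu.-integrable `[a, b] (EFin \o g) ->
  `|\int[mu]_(u in `[a, b]) (g u * weight u)| <=
  weight b * \int[mu]_(u in `[a, b]) `|g u|.
Proof.
move=> ig; have iw := integrable_weighted ig.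
rewrite (le_trans (le_normr_Rintegral _ _))// -RintegralZl//; last first.
  exact: integrable_norm.
apply: le_Rintegral => //.
- exact: integrable_norm iw.
- have -> : EFin \o (fun u => weight b * `|g u|) =
    (fun u => (weight b)%:E * (EFin \o (Num.norm \o g)) u)%E by [].
  by apply: integrableZl => //; exact: integrable_norm.
- move=> u; rewrite /= in_itv/= => /andP[_ ub].
  rewrite normrM mulrC (ger0_norm (expR_ge0 _)) ler_wpM2r// ler_expR.
  by rewrite ler_wpM2l.
Qed.

(** [[a, b]] is covered by at most [b - a + 1] unit intervals. *)
Lemma Rintegral_unit_windows g (eps a b : R) : a <= b ->
  (forall a b, mu.-integrable `[a, b] (EFin \o g)) ->
  (forall u, 0 <= g u) ->
  (forall t, \int[mu]_(u in `[t, t + 1]) g u <= eps) ->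
  \int[mu]_(u in `[a, b]) g u <= eps * (b - a + 1).
Proof.
move=> ab ig g0 geps.
have eps0 : 0 <= eps by apply: le_trans (geps 0); exact: Rintegral_ge0.
have windows n : \int[mu]_(u in `[a, a + n%:R]) g u <= eps * n%:R.
  elim: n => [|n IHn].
    by rewrite addr0 mulr0 set_itv1 Rintegral_set1.
  rewrite -natr1 addrA (@Rintegral_itv_chasles _ _ _ (a + n%:R))//.
  - by rewrite mulrDr mulr1 lerD.
  - by rewrite lerDl.
  - by rewrite lerDl.
pose n := (Num.truncn (b - a)).+1.
have /andP[nle nlt] : (Num.truncn (b - a))%:R <= b - a < n%:R.
  by apply: truncn_itv; rewrite subr_ge0.
have bn : b <= a + n%:R by rewrite -lerBlDl ltW.
apply: (@le_trans _ _ (\int[mu]_(u in `[a, a + n%:R]) g u)).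
  by rewrite (Rintegral_itv_chasles ab bn)// lerDl Rintegral_ge0.
by rewrite (le_trans (windows n))// ler_wpM2l// /n -natr1 lerD2r.
Qed.

End weighted_integrals.

Section lif_firing_system.
Variables (R : realType) (sigma vs : R) (f : R -> R).
Hypotheses (sigma0 : 0 <= sigma) (vs0 : 0 < vs).
Hypothesis f_ap : S1_almost_periodic f.
Hypothesis f_gt : {ae lebesgue_measure, forall t : R, vs < f t - sigma}.
Local Notation mu := (@lebesgue_measure R).
Local Notation drive := (fun u => (f u - sigma) * expR (sigma * u)).

Let integrable_drive a b : mu.-integrable `[a, b] (EFin \o drive).
Proof. exact: integrable_forced_weight f_ap.1. Qed.

Lemma drive_integral_ge a b : a <= b ->
  vs * expR (sigma * a) * (b - a) <= \int[mu]_(u in `[a, b]) drive u.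
Proof.
move=> ab; rewrite -Rintegral_itv_cst//.
apply: ae_le_Rintegral => //.
- exact: integrable_itv_cst.
- case: f_gt => N [mN N0 hN]; exists N; split => //.
  apply: subset_trans hN => u /=; apply: contra_not => fu.
  rewrite in_itv/= => /andP[au _].
  apply: ler_pM; [exact: ltW|exact: expR_ge0|exact: ltW|].
  by rewrite ler_expR ler_wpM2l.
Qed.

(** The integral from [t] is continuous and has reached the threshold at
    [t + vs^-1], so it takes the threshold as a value; it is increasing, so this
    happens at the first firing time. *)
Lemma firing_timesE (F : R -> R) t :
  (forall a b, a <= b -> F b - F a = \int[mu]_(u in `[a, b]) drive u) ->
  exists2 s, t < s /\ F s = F t + expR (sigma * t) &
    firing_times sigma f t = `[s, +oo[%classic.
Proof.
move=> FE; pose J s := \int[mu]_(u in `[t, s]) drive u.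
pose T := t + vs^-1.
have tT : t <= T by rewrite lerDl invr_ge0 ltW.
have J_t : J t = 0 by rewrite /J set_itv1 Rintegral_set1.
have J_T : expR (sigma * t) <= J T.
  rewrite (le_trans _ (drive_integral_ge tT))// /T addrC addKr.
  by rewrite mulrAC mulfV ?gt_eqF// mul1r.
have [] := @IVT _ J t T (expR (sigma * t)) tT.
- exact: parameterized_integral_continuous (integrable_drive _ _).
- by rewrite J_t ge_min expR_ge0/= le_max J_T orbT.
move=> s; rewrite in_itv/= => /andP[ts _] Js.
have {}ts : t < s.
  rewrite lt_neqAle ts andbT; apply/eqP => tseq.
  by have := expR_gt0 (sigma * t); rewrite -Js -tseq J_t ltxx.
have Fincr a b : a <= b -> vs * expR (sigma * a) * (b - a) <= F b - F a.
  by move=> ab; rewrite FE// drive_integral_ge.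
have Fs : F s = F t + expR (sigma * t).
  by rewrite -Js /J -(FE _ _ (ltW ts)) addrC subrK.
exists s; first by [].
apply/seteqP; split => r; rewrite /firing_times /= in_itv/= andbT.
  move=> [tr]; rewrite -(FE _ _ (ltW tr)) => Fr.
  rewrite leNgt; apply/negP => rs.
  have := Fincr _ _ (ltW rs); rewrite Fs leNgt => /negP; apply.
  rewrite (@le_lt_trans _ _ 0)//; first by lra.
  by rewrite !mulr_gt0 ?expR_gt0// subr_gt0.
move=> sr; have tr : t < r by exact: lt_le_trans ts sr.
split=> //; rewrite -(FE _ _ (ltW tr)).
have := Fincr _ _ sr; have : 0 <= vs * expR (sigma * s) * (r - s).
  by rewrite !mulr_ge0 ?expR_ge0 ?subr_ge0// ltW.
by rewrite Fs; lra.
Qed.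

Lemma lif_firing_system : exists F : R -> R,
  (forall a b, a <= b -> F b - F a = \int[mu]_(u in `[a, b]) drive u) /\
  firing_system sigma vs F (firing_map sigma f).
Proof.
have [F FE] := integral_primitive integrable_drive.
exists F; split => //; split => [a b ab|t].
  by rewrite FE// drive_integral_ge.
have [s [ts Fs] fE] := firing_timesE t FE.
suff -> : firing_map sigma f t = s by [].
by rewrite /firing_map fE inf_itv.
Qed.

Lemma S1_norm_window (g : R -> R) (eps t : R) :
  mu.-integrable `[t, t + 1] (EFin \o g) ->
  (S1_norm g < eps%:E)%E -> \int[mu]_(u in `[t, t + 1]) `|g u| <= eps.
Proof.
move=> ig geps.
have le_eps : (\int[mu]_(u in `[t, (t + 1)%R]) `|g u|%:E <= eps%:E)%E.
  apply: le_trans (ltW geps); apply: ereal_sup_ubound.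
  by exists t.
rewrite -lee_fin /Rintegral fineK//.
exact: integrable_fin_num (integrable_norm ig).
Qed.

(** Almost periods of [f] in S^1-norm are almost periods of the primitive,
    since the difference of the translated and original increments is the
    weighted integral of [f (u + tau) - f u]. *)
Lemma lif_almost_periodic_primitive (F : R -> R) :
  (forall a b, a <= b -> F b - F a = \int[mu]_(u in `[a, b]) drive u) ->
  almost_periodic_primitive sigma F.
Proof.
move=> FE eps eps0; have [l l0 lP] := f_ap.2 _ eps0; exists l => // x.
have [tau [tauP taux]] := lP x; exists tau; split => //.
move=> a b ab /=.
pose g := (f \o shift tau) \- f.
have ftau := locally_integrable_shift tau f_ap.1.
have ig c d : mu.-integrable `[c, d] (EFin \o g).
  apply: locally_integrable_itv; apply: locally_integrableB => //.
  exact: f_ap.1.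
have diffE : (translate_primitive sigma tau F b -
    translate_primitive sigma tau F a) - (F b - F a) =
    \int[mu]_(u in `[a, b]) (g u * expR (sigma * u)).
  rewrite /translate_primitive -mulrBr !FE ?lerD2r//.
  have mdrive : measurable_fun [set: R] drive.
    have [mf _ _] := f_ap.1.
    apply: measurable_funM; first exact: measurable_funB.
    apply: continuous_measurable_fun; exact: continuous_weight.
  have shiftE u : expR (- (sigma * tau)) * drive (u + tau) =
      (f (u + tau) - sigma) * expR (sigma * u).
    by rewrite mulrCA -expRD; congr (_ * expR _); ring.
  have iftau := integrable_forced_weight sigma0 a b ftau.
  have idrive : mu.-integrable `[a, b] (EFin \o (drive \o shift tau)).
    have -> : EFin \o (drive \o shift tau) = (fun u => (expR (sigma * tau))%:E *
        (EFin \o (fun u => (f (u + tau) - sigma) * expR (sigma * u))%R) u)%E.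
      apply/funext => u /=; rewrite -EFinM -shiftE.
      rewrite (mulrA (expR (sigma * tau))) -expRD subrr.
      by rewrite expR0 mul1r.
    exact: integrableZl.
  rewrite Rintegral_shift// -RintegralZl//.
  under eq_Rintegral do rewrite shiftE.
  rewrite -RintegralB//; apply: eq_Rintegral => u _ /=.
  by rewrite /g /=; ring.
have gle : `|\int[mu]_(u in `[a, b]) (g u * expR (sigma * u))| <=
    expR (sigma * b) * eps * (b - a + 1).
  rewrite (le_trans (normr_weighted_le sigma0 (ig _ _)))// -mulrA.
  rewrite ler_wpM2l ?expR_ge0//; apply: Rintegral_unit_windows => //.
  - by move=> c d; exact: integrable_norm.
  - by move=> t; exact: S1_norm_window tauP.
by rewrite -diffE ler_norml in gle; move/andP: gle => [? ?]; split; lra.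
Qed.

End lif_firing_system.

Theorem theorem6p14 (R : realType) (sigma : R) (f : R -> R) :
  0 <= sigma ->
  S1_almost_periodic f ->
  (exists2 varsigma : R, 0 < varsigma &
    {ae lebesgue_measure, forall t : R, varsigma < f t - sigma}) ->
  (forall t : R, firing_rate_exists sigma f t) /\
  (forall t : R, firing_rate sigma f t = firing_rate sigma f 0) /\
  0 < firing_rate sigma f 0.
Proof.
move=> sigma0 f_ap [vs vs0 f_gt].
have [F [FE FP]] := lif_firing_system sigma0 vs0 f_ap f_gt.
have Fap := lif_almost_periodic_primitive sigma0 f_ap FE.
have [rho rho0 rhoP] := firing_system_rate sigma0 vs0 FP Fap.
have rateE t : firing_rate sigma f t = rho by apply/cvg_lim => //; exact: rhoP.
split=> [t|]; last by split=> [t|]; rewrite !rateE.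
split=> [n|]; last by apply/cvg_ex; exists rho; exact: rhoP.
have [s _ fE] := firing_timesE sigma0 vs0 f_ap f_gt
  (iter n (firing_map sigma f) t) FE.
by exists s; rewrite fE /= in_itv/= lexx.
Qed.
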